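(* Let $\mathbf{H}$ be an $m\times n$ parity check matrix, let $K$ be a positive integer and let $\epsilon\ge 0$. If the LDPC code defined by $\mathbf{H}$ is $K$ parallel encodable by block-diagonalization (with maximum imbalance ratio $\epsilon$), then $$ n-m \;\ge\; \min_{\Pi_K^{(\epsilon)}} |\mathcal{X}(\Pi_K^{(\epsilon)})|, $$ where the minimum is over all $K$-way $\epsilon$-balanced partitions $\Pi_K^{(\epsilon)}$ of the hypergraph $\mathcal{H}_{\mathbf{H}}$ associated with $\mathbf{H}$, and $|\mathcal{X}(\Pi_K^{(\epsilon)})|$ is the cutsize of $\Pi_K^{(\epsilon)}$.
   Context: Matrices have entries in a fixed field. For an $m\times n$ matrix $\mathbf{H}=(h_{i,j})$, the hypergraph $\mathcal{H}_{\mathbf{H}}=(\mathcal{U},\mathcal{E})$ has $m$ vertices $u_1,\dots,u_m$ (one for each row) and $n$ nets (hyperedges) $e_1,\dots,e_n$ (one for each column, counted with multiplicity), with $u_i\in e_j$ if and only if $h_{i,j}\ne 0$. A $K$-way partition $\Pi_K=\{\mathcal{U}_1,\dots,\mathcal{U}_K\}$ of $\mathcal{H}_{\mathbf{H}}$ is a family of $K$ non-empty pairwise disjoint subsets of $\mathcal{U}$ with union $\mathcal{U}$. A net connects to a part $\mathcal{U}_i$ if it contains some vertex of $\mathcal{U}_i$. A net is a cut if it connects to more than one part; $\mathcal{X}(\Pi_K)$ is the set of cuts and $|\mathcal{X}(\Pi_K)|$ is the cutsize. The partition is $\epsilon$-balanced if $\max_{1\le i\le K}|\mathcal{U}_i|\le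 \frac{|\mathcal{U}|}{K}(1+\epsilon)$. The code defined by $\mathbf{H}$ is $K$ parallel encodable by block-diagonalization if there exist positive integers $m_1,\dots,m_K$ with $\sum_i m_i=m$ and $\max_i m_i\le(1+\epsilon)m/K$, and permutation matrices $\mathbf{P}$ ($m\times m$) and $\mathbf{Q}$ ($n\times n$), such that $$\mathbf{P}\mathbf{H}\mathbf{Q}=\begin{pmatrix}\mathbf{H}_P & \mathbf{H}_I\end{pmatrix}=\begin{pmatrix}\mathbf{H}_{P,1} & & \mathbf{O} & \mathbf{H}_{I,1}\\ & \ddots & & \vdots\\ \mathbf{O} & & \mathbf{H}_{P,K} & \mathbf{H}_{I,K}\end{pmatrix},$$ where $\mathbf{H}_P$ is block diagonal with blocks $\mathbf{H}_{P,1},\dots,\mathbf{H}_{P,K}$ and each $\mathbf{H}_{P,i}$ is a non-singular $m_i\times m_i$ matrix. *)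

(* Defs.v *)
From HB Require Import structures.
From mathcomp Require Import all_boot all_order all_algebra.

Set Implicit Arguments.
Unset Strict Implicit.
Unset Printing Implicit Defensive.

Import Order.TTheory GRing.Theory Num.Theory.
Local Open Scope ring_scope.

(** A hypergraph with vertex set [V] and nets indexed by [E] is its incidence
    map [net : E -> {set V}]; indexing the nets keeps track of multiplicity. *)
Section Hypergraph.

Variables (V E : finType) (net : E -> {set V}).

Definition is_Kway_partition (K : nat) (P : {set {set V}}) : bool :=
  partition P [set: V] && (#|P| == K).

Definition connects (e : E) (A : {set V}) : bool := [exists u in A, u \in net e].

Definition is_cut (P : {set {set V}}) (e : E) : bool :=
  (1 < #|[set A in P | connects e A]|)%N.

Definition cuts (P : {set {set V}}) : {set E} := [set e | is_cut P e].

Definition cutsize (P : {set {set V}}) : nat := #|cuts P|.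

Definition balanced (R : realFieldType) (K : nat) (eps : R)
    (P : {set {set V}}) : bool :=
  ((\max_(A in P) #|A|)%N%:R <= #|V|%:R / K%:R * (1 + eps)).

Definition balanced_Kway_partition (R : realFieldType) (K : nat) (eps : R)
    (P : {set {set V}}) : bool :=
  is_Kway_partition K P && balanced K eps P.

(** The minimum must be attained, so this fails for every [c] when there is no
    balanced [K]-way partition. *)
Definition is_min_cutsize (R : realFieldType) (K : nat) (eps : R) (c : nat) :
    Prop :=
  (exists2 P, balanced_Kway_partition K eps P & cutsize P = c) /\
  (forall P, balanced_Kway_partition K eps P -> (c <= cutsize P)%N).

End Hypergraph.

Definition hypergraph_of (F : fieldType) (m n : nat) (H : 'M[F]_(m, n)) :
    'I_n -> {set 'I_m} :=
  fun j => [set i | H i j != 0].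

(** The equations [eqm] and [eqn] only serve to type the block matrix
    [(H_P H_I)], whose dimensions are [\sum_i ms i] and [\sum_i ms i + r]. *)
Definition parallel_encodable (F : fieldType) (R : realFieldType) (m n : nat)
    (H : 'M[F]_(m, n)) (K : nat) (eps : R) : Prop :=
  exists (ms : 'I_K -> nat) (r : nat)
         (eqm : (\sum_(i < K) ms i)%N = m)
         (eqn : (\sum_(i < K) ms i + r)%N = n)
         (P : 'M[F]_m) (Q : 'M[F]_n)
         (HP : forall i : 'I_K, 'M[F]_(ms i))
         (HI : forall i : 'I_K, 'M[F]_(ms i, r)),
    [/\ forall i, (0 < ms i)%N,
        (\max_(i < K) ms i)%N%:R <= (1 + eps) * m%:R / K%:R,
        is_perm_mx P /\ is_perm_mx Q,
        forall i, HP i \in unitmx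
      & P *m H *m Q =
          castmx (eqm, eqn)
            (row_mx (\mxdiag_(i < K) HP i) (\mxcol_(i < K) HI i))].

(* Main.v *)
Require Import Defs.
From HB Require Import structures.
From mathcomp Require Import all_boot all_order all_algebra.
From mathcomp Require Import fingroup perm.

(** The row blocks of [P H Q = (H_P H_I)], pulled back along [P], form an
    [eps]-balanced [K]-way partition of the rows of [H].  A column landing in
    block [k] of [H_P] is supported on the rows of block [k], so it is not a
    cut; hence the cuts are among the [n - m] columns of [H_I]. *)

Set Implicit Arguments.
Unset Strict Implicit.
Unset Printing Implicit Defensive.

Import Order.TTheory GRing.Theory Num.Theory.
Local Open Scope ring_scope.

Section Fibers.

Variables (V E : finType) (net : E -> {set V}) (K : nat) (f : V -> 'I_K).

Definition fibers : {set {set V}} := [set f @^-1: [set k] | k : 'I_K].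

(** Surjectivity does double duty: no fiber is empty, and distinct indices have distinct fibers, so
    the image set [fibers f] has exactly [K] members. *)
Lemma fibers_Kway_partition :
  (forall k, exists u, f u = k) -> is_Kway_partition K fibers.
Proof.
move=> f_surj; have fib0 k : f @^-1: [set k] != set0.
  by have [u fu] := f_surj k; apply/set0Pn; exists u; rewrite !inE fu.
apply/andP; split; last first.
  rewrite card_imset ?card_ord // => k l eqkl.
  have [u fu] := f_surj k; have: u \in f @^-1: [set l].
    by rewrite -eqkl !inE fu.
  by rewrite !inE fu => /eqP.
apply/and3P; split.
- rewrite /cover; apply/eqP/setP => u; rewrite inE; apply/bigcupP.
  by exists (f @^-1: [set f u]); rewrite ?imset_f // !inE.
- apply/trivIsetP => _ _ /imsetP[k _ ->] /imsetP[l _ ->] neq.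
  rewrite -setI_eq0; apply: contraNT neq => /set0Pn[u].
  by rewrite !inE => /andP[/eqP <- /eqP <-].
- by apply/imsetP => -[k _ eq0]; have := fib0 k; rewrite -eq0 eqxx.
Qed.

(** Any fiber that meets [net e] must be the one over [k]. An empty net is covered too, since it
    connects to no part. *)
Lemma fibers_cutN (e : E) (k : 'I_K) :
  (forall u, u \in net e -> f u = k) -> ~~ is_cut net fibers e.
Proof.
move=> net_k; rewrite /is_cut -leqNgt -(cards1 (f @^-1: [set k])).
apply/subset_leq_card/subsetP => A; rewrite !inE.
case/andP=> /imsetP[l _ ->] /existsP[u /andP[]]; rewrite !inE => /eqP <-.
by move/net_k->.
Qed.

End Fibers.

(** The indices of block [k] are the image of ['I_(ms k)] under the injection [tagnat.Rank k]. *)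
Lemma card_sig1_fiber (K : nat) (ms : 'I_K -> nat) (k : 'I_K) :
  #|[set x : 'I_(\sum_(i < K) ms i) | tagnat.sig1 x == k]| = ms k.
Proof.
have inj : injective (@tagnat.Rank K ms k).
  move=> i j /(congr1 val)/eqP; rewrite /= tagnat.eq_Rank eqxx /=.
  by move/eqP/val_inj.
rewrite -[RHS]card_ord -cardsT -(card_imset _ inj); apply: eq_card => x.
rewrite !inE; apply/eqP/imsetP => [<-|[j _ ->]]; last by rewrite tagnat.Rank1K.
by exists (tagnat.sig2 x); rewrite ?tagnat.sig2K.
Qed.

Lemma mxdiag_eq0 (V : nmodType) (K : nat) (ms : 'I_K -> nat)
    (B : forall i, 'M[V]_(ms i)) x y :
  tagnat.sig1 x != tagnat.sig1 y -> (\mxdiag_i B i) x y = 0.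
Proof. by rewrite /mxdiag !mxE => /negPf ->; rewrite mxE. Qed.

(** Since [is_min_cutsize] asks for an attained minimum, one balanced partition is needed to start
    the search; its cutsize then bounds the minimum. *)
Lemma exists_min_cutsize (V E : finType) (net : E -> {set V})
    (R : realFieldType) (K : nat) (eps : R) (P : {set {set V}}) :
    balanced_Kway_partition K eps P ->
  exists2 c, is_min_cutsize net K eps c & (c <= cutsize net P)%N.
Proof.
move=> balP; have [Q balQ minQ] := arg_minnP (cutsize net) balP.
by exists (cutsize net Q); [split; [exists Q | exact: minQ] | exact: minQ].
Qed.

Theorem proposition1 (F : fieldType) (R : realFieldType) (m n K : nat)
    (H : 'M[F]_(m, n)) (eps : R) (hK : (0 < K)%N) (heps : 0 <= eps)
    (Henc : parallel_encodable H K eps) :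
  exists2 c : nat, is_min_cutsize (hypergraph_of H) K eps c
    & c%:Z <= n%:Z - m%:Z.
Proof.
case: Henc => ms [r [eqm [eqn [P [Q [HP [HI []]]]]]]].
move=> ms_gt0 ms_le [permP permQ] _.
subst m n; rewrite castmx_id => PHQ.
have [s def_P] := is_perm_mxP _ permP; have [t def_Q] := is_perm_mxP _ permQ.
(* Row [u] and column [e] of [H] become row [s^-1 u] and column [t e] of the block matrix. *)
have HE u e : H u e = row_mx (\mxdiag_i HP i) (\mxcol_i HI i) (s^-1%g u) (t e).
  rewrite -PHQ def_P def_Q -[t]invgK -row_permE -col_permE !mxE invgK.
  by rewrite permKV permK.
(* The part of a vertex is the block containing its permuted row. *)
pose f u := tagnat.sig1 (s^-1%g u).
have card_fiber k : #|f @^-1: [set k]| = ms k.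
  rewrite -[RHS](card_sig1_fiber ms) -(card_imset _ (@perm_inj _ s^-1%g)).
  apply: eq_card => x; apply/imsetP/idP => [[u]|]; rewrite !inE.
    by move=> + ->.
  by exists (s x); rewrite ?inE /f permK.
have f_surj k : exists u, f u = k.
  have: (0 < #|f @^-1: [set k]|)%N by rewrite card_fiber.
  by case/card_gt0P => u; rewrite !inE => /eqP; exists u.
have bal : balanced_Kway_partition K eps (fibers f).
  rewrite /balanced_Kway_partition fibers_Kway_partition //=.
  rewrite /balanced card_ord mulrAC [_ * (1 + _)]mulrC.
  apply: le_trans ms_le; rewrite ler_nat.
  by apply/bigmax_leqP => _ /imsetP[k _ ->]; rewrite card_fiber leq_bigmax.
have [c cmin c_le] := exists_min_cutsize (hypergraph_of H) bal.
exists c => //; rewrite PoszD addrAC subrr add0r lez_nat.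
(* Both sides become cardinals of sets of permuted column indices: [r] counts the image of [rshift],
   the columns of [H_I], and the cuts are moved by [t]. An inclusion then suffices. *)
apply: leq_trans c_le _; rewrite -[leqRHS]card_ord -cardsT.
rewrite -(card_imset _ (@rshift_inj (\sum_(i < K) ms i)%N r)).
rewrite /cutsize -(card_imset _ (@perm_inj _ t)).
apply/subset_leq_card/subsetP => x.
case/imsetP=> e; rewrite inE => cut_e ->; case: (split_ordP (t e)) => j te.
  (* Here [t e] is a column of [H_P], in the block of [j]; off that block its entries vanish, so all
     vertices of [e] lie in one fiber. *)
  move: cut_e; apply: contraTT => _.
  apply: (@fibers_cutN _ _ _ _ _ _ (tagnat.sig1 j)) => u.
  rewrite inE HE te row_mxEl; apply: contraNeq => neq.
  by rewrite mxdiag_eq0.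
by rewrite te imset_f.
Qed.
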